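(* Let $\rho\in V_k^\times$ and let $\mathcal A_{\rho^2,j}$ be a multiplicity-two mod $\rho$ equivalence class in a finite set $\mathcal A$ of faithful degree-$(k+1)$ weight monomials for $G_k$ with no zero weight factor. Then $$|\mathcal A_{\rho^2,j}|\equiv m(\mathcal A_{\rho^2,j},\beta)\equiv 0\pmod 2\quad\text{for every }\beta\in V_k^\times$$ if and only if $$\sum_{\tau\in\mathcal A_{\rho^2,j}}\alpha_\tau(\rho)=0\quad\text{in }G_k.$$
   Context: $G_k=(\mathbb Z_2)^k$, regarded as a $k$-dimensional $\mathbb Z_2$-vector space; $V_k=\operatorname{Hom}(G_k,\mathbb Z_2)$, $V_k^\times=V_k\setminus\{0\}$. Elements of $V_k$ are called weights. A weight monomial of degree $n$ for $G_k$ is a formal commutative product $\tau=\rho_1\cdots\rho_n$ of weights; it is faithful if its factors span $V_k$; ''no zero weight factor'' means all $\rho_i\ne0$. $m(\tau,\rho)$ is the multiplicity of $\rho$ as a factor of $\tau$, and $m(\mathcal C,\rho)=\sum_{\tau\in\mathcal C}m(\tau,\rho)$ for a finite set $\mathcal C$ of weight monomials. For $\rho\in V_k^\times$ and $\tau=\rho^d\rho_1\cdots\rho_{n-d}$ with all $\rho_i\neq\rho$, put $(\tau/\rho^d)|_{\ker\rho}=(\rho_1|_{\ker\rho})\cdots(\rho_{n-d}|_{\ker\rho})$, a formal product of elements of $\operatorname{Hom}(\ker\rho,\mathbb Z_2)$. Weight monomials $\tau,\tau'$ are mod $\rho$ equivalent if for some $d\ge1$, $m(\tau,\rho)=m(\tau',\rho)=d$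 and $(\tau/\rho^d)|_{\ker\rho}=(\tau'/\rho^d)|_{\ker\rho}$. A multiplicity-$d$ mod $\rho$ equivalence class in $\mathcal A$ is an equivalence class, for this relation, of elements $\tau\in\mathcal A$ with $m(\tau,\rho)=d$; the multiplicity-two classes are denoted $\mathcal A_{\rho^2,j}$ with $j$ an index. For $\tau=\rho^2\rho_2\cdots\rho_k$ faithful of degree $k+1$, $\{\rho,\rho_2,\dots,\rho_k\}$ is a basis of $V_k$; let $\{\alpha_\tau(\rho),\alpha_\tau(\rho_2),\dots,\alpha_\tau(\rho_k)\}\subset G_k$ be the dual basis. The vector $\alpha_\tau(\rho)$ (determined by $\rho(\alpha_\tau(\rho))=1$, $\rho_i(\alpha_\tau(\rho))=0$ for $2\le i\le k$) is the dual pivot of $(\tau,\rho)$. *)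

(* Defs.v *)
From HB Require Import structures.
From mathcomp Require Import all_boot all_order all_algebra.
From mathcomp Require Import finmap multiset.

Set Implicit Arguments.
Unset Strict Implicit.
Unset Printing Implicit Defensive.

Import GRing.Theory.
Local Open Scope ring_scope.
Local Open Scope fset_scope.
Local Open Scope mset_scope.

Notation Z2space k := 'rV['F_2]_k.
Notation weight k := 'Hom(Z2space k, ('F_2)^o).
Notation weight_monomial k := {mset weight k}.

Section Monomials.
Variable k : nat.
Implicit Types (rho b : weight k) (t : weight_monomial k).
Implicit Types (A B : {fset weight_monomial k}).

Definition faithful t : bool := (<<t>> == fullv)%VS.

(* The multiplicity m(t, rho) is the multiset value [t rho]. *)
Definition set_mult A rho : nat := (\sum_(t <- A) t rho)%N.

Definition restrict rho b : 'Hom(subvs_of (lker rho), ('F_2)^o) :=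
  (b \o linfun vsval)%VF.

(* (t / rho^d)|_(ker rho), where d = t rho *)
Definition residue rho t : {mset 'Hom(subvs_of (lker rho), ('F_2)^o)} :=
  seq_mset [seq restrict rho b | b <- t & b != rho].

Definition mod_equiv rho t t' : bool :=
  [&& (0 < t rho)%N, t' rho == t rho & residue rho t == residue rho t'].

Definition is_mod_class A rho (d : nat) B : Prop :=
  exists2 t, (t \in A) && (t rho == d) & B = [fset t' in A | mod_equiv rho t t'].

Definition is_dual_pivot rho t (a : Z2space k) : bool :=
  (rho a == 1) && all (fun b => b a == 0) [seq b <- t | b != rho].

(* The value 0 is a junk value: see [dual_pivotP]. *)
Definition dual_pivot rho t : Z2space k := odflt 0 [pick a | is_dual_pivot rho t a].

Lemma dual_pivotP rho t a :
    faithful t -> size t = k.+1 -> t rho = 2%N ->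
  is_dual_pivot rho t a = (a == dual_pivot rho t).
Proof.
move=> /eqP ft st mt.
pose X := rho :: [seq b <- t | b != rho].
have cmt : count_mem rho t = 2%N by rewrite -mset_seqE seq_mset_id.
have sX : size X = k.
  rewrite /= size_filter; have := count_predC (pred1 rho) t.
  by rewrite cmt st => E; apply: eq_add_S; rewrite -[RHS]E.
have fX : (<<X>> = fullv)%VS.
  apply/eqP; rewrite eqEsubv subvf -ft; apply/span_subvP => b bt.
  apply: memv_span; rewrite inE mem_filter bt andbT.
  by case: eqP.
pose ev (v : Z2space k) := [ffun i : 'I_k => (X`_i v : 'F_2)].
have ev_inj : injective ev.
  move=> v w /ffunP evw.
  have hX b : b \in X -> b (v - w) = 0.
    move=> bX; have ltb : (index b X < k)%N by rewrite -[ltnRHS]sX index_mem.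
    have := evw (Ordinal ltb); rewrite !ffunE /= -/X nth_index // => E.
    by rewrite linearB /= E subrr.
  have hV b : b (v - w) = 0.
    have : b \in <<X>>%VS by rewrite fX memvf.
    rewrite -[X]in_tupleE => /coord_span ->.
    rewrite sum_lfunE big1 // => i _.
    by rewrite scale_lfunE hX ?scaler0 // in_tupleE mem_nth.
  apply/eqP; rewrite -subr_eq0; apply/eqP/rowP => j.
  pose c (u : Z2space k) : ('F_2)^o := u 0 j.
  have lc : linear c by move=> x u u'; rewrite /c !mxE.
  pose Lm := GRing.isLinear.Build _ _ _ _ c lc.
  pose cl : {linear Z2space k -> ('F_2)^o} := HB.pack c Lm.
  by have := hV (linfun cl); rewrite lfunE /= /c mxE => ->; rewrite mxE.
have ev_bij : bijective ev.
  apply: inj_card_bij => //.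
  by rewrite card_ffun card_mx mul1n !card_ord.
have pivE v : is_dual_pivot rho t v = (ev v == [ffun i : 'I_k => (i == 0 :> nat)%:R]).
  apply/andP/eqP => [[/eqP r1 /allP r0]|/ffunP E].
    apply/ffunP => -[[|i] lti]; rewrite !ffunE //=.
    by apply/eqP/r0/mem_nth; move: lti; rewrite -{1}sX.
  have k0 : (0 < k)%N by rewrite -sX.
  split; first by have := E (Ordinal k0); rewrite !ffunE /= => ->.
  apply/allP => b bX; have ltb : ((index b [seq b <- t | b != rho]).+1 < k)%N.
    by rewrite -[ltnRHS]sX ltnS index_mem.
  by have := E (Ordinal ltb); rewrite !ffunE /= nth_index // => ->.
have [g gK Kg] := ev_bij.
have pg v : is_dual_pivot rho t v = (v == g [ffun i : 'I_k => (i == 0 :> nat)%:R]).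
  by rewrite pivE -(can_eq Kg) gK.
rewrite /dual_pivot; case: pickP => [u|/(_ (g [ffun i : 'I_k => (i == 0 :> nat)%:R]))].
  by rewrite !pg => /eqP ->.
by rewrite pg eqxx.
Qed.

End Monomials.

(* Main.v *)
Require Import Defs.
From mathcomp Require Import all_boot all_order all_algebra.
From mathcomp Require Import finmap multiset.

(** Fix one monomial [t0] of the class.  A class member [t] arises from [t0] by
    replacing some of the factors [b != rho] by [b + rho], the only other
    weight with the same restriction to [ker rho].  Its dual pivot [a] records
    these choices: if the restriction of [b] is a factor of the residue, then
    [b a = 0] when [b] divides [t], and [b a = 1] when [b + rho] does.  Hence
    [t b = 1 + b a] modulo 2 ([mult_dual_pivot]).  Of the remaining weights,
    [rho] has multiplicity two and the others divide no member of the class.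

    Let [S] be the sum of the dual pivots.  Summing over the class [B] gives
    [rho S = |B|] and [m(B, b) = |B| + b S] in the two-element field
    ([sum_pivot_rho], [sum_pivot_mult]).  So [S = 0] forces all the parities.
    Conversely the parities make [S] vanish under all factors of [t0], [rho]
    included; adding [S] to the dual pivot of [t0] then gives a dual pivot of
    [t0] again, and [S = 0] because that pivot is unique. *)

Set Implicit Arguments.
Unset Strict Implicit.
Unset Printing Implicit Defensive.

Import GRing.Theory.
Local Open Scope ring_scope.

Lemma F2_cases (x : 'F_2) : x = 0 \/ x = 1.
Proof. by case: x => [[|[|n]] lt_n] //; [left | right]; apply: val_inj. Qed.

Lemma F2_natr_eq0 (n : nat) : (n%:R == 0 :> 'F_2) = (n %% 2 == 0)%N.
Proof. by rewrite -(dvdn_pcharf (pchar_Fp _)). Qed.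

Lemma F2_addrr (x : 'F_2) : x + x = 0.
Proof. by case: (F2_cases x) => ->; apply: val_inj. Qed.

Local Open Scope fset_scope.
Local Open Scope mset_scope.

Section Monomials.
Local Open Scope ring_scope.
Variable k : nat.
Implicit Types (rho b : weight k) (t : weight_monomial k) (a : Z2space k).

(** A vector [a] off the hyperplane [ker rho] splits the space, so a weight is
    its restriction to [ker rho] together with its value at [a]. *)
Lemma restrict_inj_mod rho b b' a :
    rho a = 1 -> b' a = 0 -> restrict rho b = restrict rho b' ->
  b = b' + b a *: rho.
Proof.
move=> rho_a b'_a eq_res; apply/lfunP => v.
have ker_v : v - rho v *: a \in lker rho.
  by rewrite memv_ker linearB linearZ /= rho_a [_ *: 1]mulr1 subrr.
have := congr1 (fun f : 'Hom(_, _) => f (Subvs ker_v)) eq_res.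
rewrite !comp_lfunE !lfunE /= !linearB !linearZ /= b'_a oppr0.
rewrite [_ *: 0]mulr0 addr0 => <-.
by rewrite scale_lfunE [b a *: _]mulrC [_ *: - _]mulrN subrK.
Qed.

Lemma mem_residue rho b t :
  b \in t -> b != rho -> restrict rho b \in residue rho t.
Proof.
move=> bt nb; rewrite (perm_mem (perm_eq_seq_mset _)).
by apply: map_f; rewrite mem_filter nb.
Qed.

Section Faithful.
Variables (rho : weight k) (t : weight_monomial k).
Hypotheses (t_faithful : faithful t) (t_size : size t = k.+1).
Hypothesis t_rho : t rho = 2%N.

Lemma dual_pivot_spec : is_dual_pivot rho t (dual_pivot rho t).
Proof. by rewrite dual_pivotP. Qed.

Lemma dual_pivot_rho : rho (dual_pivot rho t) = 1.
Proof. by have /andP[/eqP] := dual_pivot_spec. Qed.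

Lemma dual_pivot_factor b : b \in t -> b != rho -> b (dual_pivot rho t) = 0.
Proof.
by move=> bt nb; have /andP[_ /allP/(_ b)] := dual_pivot_spec;
  rewrite mem_filter nb bt => /(_ isT)/eqP.
Qed.

(** Once one copy of [rho] is dropped, the [k] remaining factors still span
    the [k]-dimensional space of weights, so they form a basis. *)
Lemma factor_mult1 b : b \in t -> b != rho -> t b = 1%N.
Proof.
move=> bt nb; pose X := rem rho t.
have rho_t : rho \in t by rewrite -mset_neq0 t_rho.
have perm_t : perm_eq t (rho :: X) by apply: perm_to_rem.
have count_X c : (t c = (rho == c) + count_mem c X)%N.
  by rewrite -[t in LHS]seq_mset_id mset_seqE (permP perm_t).
have rho_X : rho \in X.
  have := count_X rho; rewrite t_rho eqxx => -[count_rho].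
  by rewrite -has_pred1 has_count -[count _ _]count_rho.
have free_X : free X.
  rewrite /free.
  have -> : (<<X>> = fullv)%VS.
    apply/eqP; rewrite eqEsubv subvf -(eqP t_faithful).
    apply/span_subvP => c; rewrite (perm_mem perm_t) inE.
    by case/predU1P => [->|cX]; apply: memv_span.
  rewrite size_rem // t_size /= dimvf /dim /= dim_matrix mul1r.
  by rewrite [X in X == _]muln1.
have bX : b \in X by move: bt; rewrite (perm_mem perm_t) inE (negPf nb).
by rewrite (count_X b) eq_sym (negPf nb) count_uniq_mem ?free_uniq // bX.
Qed.

(** The lift of [restrict rho b] that divides [t] is the one killed by the dual
    pivot: it is [b] itself when [b] is killed, and [b + rho] otherwise. *)
Lemma mult_dual_pivot b :
    b != rho -> restrict rho b \in residue rho t ->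
  (t b)%:R = 1 + b (dual_pivot rho t) :> 'F_2.
Proof.
rewrite (perm_mem (perm_eq_seq_mset _)) => nb /mapP[b'].
rewrite mem_filter => /andP[nb' b't] eq_res.
have Eb := restrict_inj_mod dual_pivot_rho (dual_pivot_factor b't nb') eq_res.
have [b0|b1] := F2_cases (b (dual_pivot rho t)).
  move: Eb; rewrite b0 scale0r !addr0 => ->.
  by rewrite factor_mult1.
have bNt : b \notin t.
  by apply/negP => bt; move: b1; rewrite dual_pivot_factor.
by rewrite b1 (mset_eq0P bNt) F2_addrr.
Qed.

End Faithful.

Section Class.
Variables (rho : weight k) (A B : {fset weight_monomial k}).
Hypothesis A_faithful : forall t, t \in A -> faithful t.
Hypothesis A_size : forall t, t \in A -> size t = k.+1.
Variable t0 : weight_monomial k.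
Hypothesis t0_rho : t0 rho = 2%N.
Hypothesis B_def : B = [fset t in A | mod_equiv rho t0 t].

Let S := \sum_(t <- B) dual_pivot rho t.

Lemma classP t : t \in B ->
  [/\ faithful t, size t = k.+1, t rho = 2%N & residue rho t = residue rho t0].
Proof.
rewrite B_def !inE => /andP[tA /and3P[_ /eqP t_rho /eqP res_t]].
by rewrite t_rho A_faithful ?A_size.
Qed.

Lemma sum_pivot_rho : rho S = #|` B|%:R.
Proof.
rewrite linear_sum /= (eq_big_seq (fun=> 1)).
  by rewrite big_const_seq count_predT iter_addr_0.
by move=> t /classP[ft st mt _]; apply: dual_pivot_rho.
Qed.

Lemma sum_pivot_mult b : b != rho -> restrict rho b \in residue rho t0 ->
  (set_mult B b)%:R = #|` B|%:R + b S :> 'F_2.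
Proof.
move=> nb res_b.
rewrite -sum_pivot_rho !linear_sum /= natr_sum -big_split /=.
apply: eq_big_seq => t /classP[ft st mt res_t].
by rewrite dual_pivot_rho // (@mult_dual_pivot rho) ?res_t.
Qed.

Lemma set_mult_residue0 b : b != rho -> restrict rho b \notin residue rho t0 ->
  set_mult B b = 0%N.
Proof.
move=> nb res_b; rewrite /set_mult big_seq big1 // => t /classP[_ _ _ res_t].
by apply/mset_eq0P; apply: contra res_b => bt; rewrite -res_t mem_residue.
Qed.

Lemma set_mult_rho : set_mult B rho = (#|` B| * 2)%N.
Proof.
rewrite /set_mult (eq_big_seq (fun=> 2%N)) => [|t /classP[]//].
by rewrite big_const_seq count_predT iter_addn_0 mulnC.
Qed.

End Class.

End Monomials.

Theorem proposition4p2 (k : nat) (rho : weight k)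
    (A B : {fset weight_monomial k})
    (rho_neq0 : rho != 0)
    (A_faithful : forall t : weight_monomial k, t \in A -> faithful t)
    (A_degree : forall t : weight_monomial k, t \in A -> size t = k.+1)
    (A_nonzero : forall t : weight_monomial k, t \in A -> 0 \notin t)
    (B_class : is_mod_class A rho 2 B) :
  (forall b : weight k, b != 0 ->
     #|` B| = set_mult B b %[mod 2] /\ set_mult B b = 0 %[mod 2])
  <-> \sum_(t <- B) dual_pivot rho t = 0.
Proof.
have [t0 /andP[t0A /eqP t0_rho] B_def] := B_class.
have [ft0 st0] := (A_faithful _ t0A, A_degree _ t0A).
have rhoS := sum_pivot_rho A_faithful A_degree t0_rho B_def.
have bS := sum_pivot_mult A_faithful A_degree t0_rho B_def.
set S := \sum_(t <- B) _ in rhoS bS *.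
split=> [even_B|S0].
  have card0 : #|` B|%:R = 0 :> 'F_2.
    by apply/eqP; rewrite F2_natr_eq0; have [-> ->] := even_B rho rho_neq0.
  have: is_dual_pivot rho t0 (dual_pivot rho t0 + S).
    rewrite /is_dual_pivot linearD /= dual_pivot_rho // rhoS card0 addr0 eqxx /=.
    apply/allP => b; rewrite mem_filter => /andP[nb bt0].
    rewrite linearD /= dual_pivot_factor // add0r.
    have [->|b0] := eqVneq b 0; first by rewrite lfunE.
    have := bS b nb (mem_residue bt0 nb); rewrite card0 add0r => <-.
    by rewrite F2_natr_eq0; have [_ ->] := even_B b b0.
  by rewrite dual_pivotP // -subr_eq0 addrC addKr => /eqP.
have card0 : #|` B|%:R = 0 :> 'F_2 by rewrite -rhoS S0 linear0.
have cardB : #|` B| = 0 %[mod 2] by apply/eqP; rewrite -F2_natr_eq0 card0.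
move=> b _; suff multB : set_mult B b = 0 %[mod 2] by rewrite cardB multB.
have [->|nb] := eqVneq b rho.
  by rewrite (set_mult_rho A_faithful A_degree t0_rho B_def) modnMl.
have [res_b|res_b] := boolP (restrict rho b \in residue rho t0).
  by apply/eqP; rewrite -F2_natr_eq0 bS // S0 linear0 card0 addr0.
by rewrite (set_mult_residue0 A_faithful A_degree t0_rho B_def).
Qed.
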